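(* For each $(i_{1},i_{2},i_{3})\in\{(1,2,3),(1,3,4)\}$ there are infinitely many triples $(a,b,c)$ of rational numbers with $c\neq 0$ such that the system \[ \sigma_{i_{1}}(P,Q,R,S)=a,\qquad \sigma_{i_{2}}(P,Q,R,S)=b,\qquad \sigma_{i_{3}}(P,Q,R,S)=c \] has infinitely many solutions $(P,Q,R,S)$ in rational numbers.
   Context: For $1\leq i\leq 4$, $\sigma_{i}(x_{1},\ldots,x_{4})=\sum_{1\leq k_{1}<\cdots<k_{i}\leq 4}x_{k_{1}}\cdots x_{k_{i}}$ denotes the $i$-th elementary symmetric polynomial in four variables. *)

(* Defs.v *)
From mathcomp Require Import all_boot all_order all_algebra.
From mathcomp Require mpoly.
From mathcomp Require Import classical_sets cardinality.

Set Implicit Arguments.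
Unset Strict Implicit.
Unset Printing Implicit Defensive.

Local Open Scope ring_scope.

Definition sigma (i : nat) (x1 x2 x3 x4 : rat) : rat :=
  mpoly.meval (tnth [tuple x1; x2; x3; x4]) (mpoly.mesym 4 rat i).

(* Main.v *)
Require Import Defs.
From mathcomp Require Import all_boot all_order all_algebra.
From mathcomp Require Import classical_sets cardinality.
From mathcomp Require mpoly.
From mathcomp Require Import ring lra.

(** Each system contains rational curves for explicit parameters.  For (1,2,3),
    the roots [p, -p, q, -q] of [(x^2 - p^2)(x^2 - q^2)] with [p^2 + q^2 = 1]
    have constant first three symmetric functions, and translating them by [t]
    makes the third one [4t^3 - 2t], nonzero for positive integers [t].  For
    (1,3,4), the quadruples [(p, -p, k/p, -k/p)] satisfy sigma1 = sigma3 = 0 and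
    sigma4 = k^2. *)

Set Implicit Arguments.
Unset Strict Implicit.
Unset Printing Implicit Defensive.

Import Order.TTheory GRing.Theory Num.Theory.

Local Open Scope classical_set_scope.
Local Open Scope ring_scope.

(** Vieta's formulas: up to the sign [(-1) ^+ i], [sigma i] is the coefficient of degree [4 - i] in
    the monic quartic with roots [p, q, r, s]. *)
Lemma sigmaE (p q r s : rat) :
  [/\ sigma 1 p q r s = p + q + r + s,
      sigma 2 p q r s = p * q + p * r + p * s + q * r + q * s + r * s,
      sigma 3 p q r s = p * q * r + p * q * s + p * r * s + q * r * s
    & sigma 4 p q r s = p * q * r * s].
Proof.
have prodE : \prod_(c <- [tuple p; q; r; s]) ('X - c%:P) =
    Poly [:: p * q * r * s;
             - (p * q * r + p * q * s + p * r * s + q * r * s);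
             p * q + p * r + p * s + q * r + q * s + r * s;
             - (p + q + r + s); 1].
  rewrite /= !big_cons big_nil !cons_poly_def !(rmorphD, rmorphN, rmorphM) /=.
  ring.
have sE (i : 'I_5) : sigma i p q r s = (-1) ^+ i *
    (\prod_(c <- [tuple p; q; r; s]) ('X - c%:P))`_(4 - i).
  by rewrite mpoly.mroots_coeff signrMK.
split.
- by rewrite (sE (@Ordinal 5 1 isT)) prodE coef_Poly /=; ring.
- by rewrite (sE (@Ordinal 5 2 isT)) prodE coef_Poly /=; ring.
- by rewrite (sE (@Ordinal 5 3 isT)) prodE coef_Poly /=; ring.
- by rewrite (sE (@Ordinal 5 4 isT)) prodE coef_Poly /=; ring.
Qed.

Lemma infinite_of_inj (T : Type) (A : set T) (f : nat -> T) :
  injective f -> (forall n, A (f n)) -> infinite_set A.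
Proof.
move=> f_inj fA /(finite_preimage (in2W f_inj)).
have -> : f @^-1` A = setT by apply/seteqP; split=> // n _; exact: fA.
exact: infinite_nat.
Qed.

(** Second intersection of the unit circle with the line of slope [n] through [(-1, 0)]. The
    abscissa [(1 - n^2) / (1 + n^2)] is written with a single [n], so that injectivity follows by
    cancellation. *)
Definition circle_x (n : nat) : rat := 2 / (1 + n%:R ^+ 2) - 1.
Definition circle_y (n : nat) : rat := 2 * n%:R / (1 + n%:R ^+ 2).

Lemma circle_denom_neq0 (n : nat) : 1 + n%:R ^+ 2 != 0 :> rat.
Proof. by rewrite gt_eqF // ltr_pwDl // exprn_ge0. Qed.

Lemma circleE (n : nat) : circle_x n ^+ 2 = 1 - circle_y n ^+ 2.
Proof. rewrite /circle_x /circle_y; field; exact: circle_denom_neq0. Qed.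

Lemma circle_x_inj : injective circle_x.
Proof.
move=> m n /addIr /(mulfI (isT : (2 : rat) != 0)) /invr_inj /addrI /eqP.
by rewrite eqrXn2 // eqr_nat => /eqP.
Qed.

Lemma infinite_solutions_123 (t : rat) :
  infinite_set [set x : rat * rat * rat * rat |
    let: (p, q, r, s) := x in
    [/\ sigma 1 p q r s = 4 * t, sigma 2 p q r s = 6 * t ^+ 2 - 1
      & sigma 3 p q r s = 4 * t ^+ 3 - 2 * t]].
Proof.
pose f n := (t + circle_x n, t - circle_x n, t + circle_y n, t - circle_y n).
apply: (@infinite_of_inj _ _ f) => [m n [/addrI /circle_x_inj //]|n] /=.
have xE := circleE n.
have [-> -> -> _] := sigmaE (t + circle_x n) (t - circle_x n)
  (t + circle_y n) (t - circle_y n).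
(* With [x], [y] the circle coordinates, the last two values are [6t^2 - (x^2 + y^2)] and
   [4t^3 - 2t(x^2 + y^2)]. *)
by split; ring: xE.
Qed.

Lemma infinite_solutions_134 (k : rat) :
  infinite_set [set x : rat * rat * rat * rat |
    let: (p, q, r, s) := x in
    [/\ sigma 1 p q r s = 0, sigma 3 p q r s = 0 & sigma 4 p q r s = k ^+ 2]].
Proof.
(* The shift to [n.+1] keeps the denominator nonzero; the first coordinate alone gives injectivity,
   even for [k = 0]. *)
pose f n : rat * rat * rat * rat :=
  (n.+1%:R, - n.+1%:R, k / n.+1%:R, - (k / n.+1%:R)).
apply: (@infinite_of_inj _ _ f) => [m n [/eqP]|n] /=.
  by rewrite eqr_nat => /eqP [].
have [-> _ -> ->] := sigmaE n.+1%:R (- n.+1%:R) (k / n.+1%:R) (- (k / n.+1%:R)).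
have : n.+1%:R != 0 :> rat by rewrite pnatr_eq0.
move: (n.+1%:R : rat) => x x0.
by split; [ring | field | field].
Qed.

Theorem theorem4 (i1 i2 i3 : nat)
    (hi : (i1, i2, i3) = (1, 2, 3)%N \/ (i1, i2, i3) = (1, 3, 4)%N) :
  infinite_set [set t : rat * rat * rat |
    let: (a, b, c) := t in
    c <> 0 /\
    infinite_set [set x : rat * rat * rat * rat |
      let: (p, q, r, s) := x in
      [/\ sigma i1 p q r s = a, sigma i2 p q r s = b & sigma i3 p q r s = c]]].
Proof.
case: hi => -[-> -> ->].
- pose f n : rat * rat * rat :=
    (4 * n.+1%:R, 6 * n.+1%:R ^+ 2 - 1, 4 * n.+1%:R ^+ 3 - 2 * n.+1%:R).
  apply: (@infinite_of_inj _ _ f) => [m n [+ _ _]|n] /=.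
    by move=> /(mulfI (isT : (4 : rat) != 0)) /eqP; rewrite eqr_nat => /eqP [].
  split; last exact: infinite_solutions_123.
  (* For [t >= 1], [4t^3 - 2t = 2t(2t^2 - 1)] is positive. *)
  have : 1 <= n.+1%:R :> rat by rewrite ler1n.
  by move=> ? ?; nra.
- pose f n : rat * rat * rat := (0, 0, n.+1%:R ^+ 2).
  apply: (@infinite_of_inj _ _ f) => [m n [/eqP]|n] /=.
    by rewrite eqrXn2 // eqr_nat => /eqP [].
  split; last exact: infinite_solutions_134.
  by apply/eqP; rewrite expf_neq0 // pnatr_eq0.
Qed.
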